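(* Let $\bar g^N(x)$, $\bar g^K(x)$, $\bar g^{N*}(x)$ and $D(K)$ be as defined in the context. With the same $x$ and $\epsilon$, and for any integer $p\ge 1$, we always have $$\bar g^N(x)\le\bar g^K(x).$$ Suppose in addition that the domain assumption (A) of the context holds, and that, for the given $x$, $g$ satisfies an $L$-smooth condition on its domain with respect to the $\ell_2$-norm: $$\|\nabla g(v,x)-\nabla g(u,x)\|_2\le L\|u-v\|_2$$ for all $u,v$ in the domain (gradients taken with respect to the first argument). Then, with the same $x$ and $\epsilon$, and for any integer $p\ge 1$, we always have $$\bar g^K(x)\le\bar g^{N*}(x)+\frac L2 D(K).$$
   Context: $S\subseteq\mathbf{R}^m$ is convex and closed. For all $x\in\mathcal X\subseteq\mathbf{R}^n$ ($\mathcal X$ compact) the function $u\mapsto-g(u,x)$ is proper, convex and lower-semicontinuous; its domain $\operatorname{dom}_u g$ (where $g$ is finite; $g=-\infty$ outside) does not depend on $x$, and $S\subseteq\operatorname{dom}_u g$. Assumption (A): the domain $\operatorname{dom}_u g$ is $\mathbf{R}^m$; otherwise, $g$ is either element-wise monotonically increasing in $u$ and its domain only has a (potential) lower bound, or element-wise monotonically decreasing in $u$ and its domain only has a (potential) upper bound. Data points $d_1,\dots,d_N\in S$ are partitioned into $K$ disjoint nonempty clusters with index sets $C_1,\dots,C_K$, with means $\bar d_k=\frac1{|C_k|}\sum_{i\in C_k}d_i$. $\|\cdot\|$ is a norm on $\mathbf{R}^m$ and $\epsilon>0$. Define $$\bar g^N(x)=\max\Big\{\tfrac1N\sum_{i=1}^N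 g(v_i,x)\ :\ \tfrac1N\sum_{i=1}^N\|v_i-d_i\|^p\le\epsilon^p,\ v_i\in S,\ i=1,\dots,N\Big\},$$ $$\bar g^K(x)=\max\Big\{\sum_{k=1}^K\tfrac{|C_k|}{N}g(u_k,x)\ :\ \sum_{k=1}^K\tfrac{|C_k|}{N}\|u_k-\bar d_k\|^p\le\epsilon^p,\ u_k\in S,\ k=1,\dots,K\Big\},$$ $$\bar g^{N*}(x)=\max\Big\{\tfrac1N\sum_{i=1}^N g(v_i,x)\ :\ \tfrac1N\sum_{i=1}^N\|v_i-d_i\|^p\le\epsilon^p\Big\}\quad\text{(no support constraint)},$$ and $D(K)=\frac1N\sum_{k=1}^K\sum_{i\in C_k}\|d_i-\bar d_k\|_2^2$.
   Formalization: For the second inequality, when the domain of g is not all of R^m, the norm is additionally assumed not to increase when negative coordinates are set to 0 (true for all l_q norms); for arbitrary norms the claim fails. *)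

(* Defs.v *)
From HB Require Import structures.
From mathcomp Require Import all_boot all_order all_algebra.
From mathcomp Require Import all_classical all_reals all_analysis.

Set Implicit Arguments.
Unset Strict Implicit.
Unset Printing Implicit Defensive.

Import Order.TTheory GRing.Theory Num.Theory.
Import numFieldNormedType.Exports.

Local Open Scope classical_set_scope.
Local Open Scope ring_scope.

Section ConvexAnalysis.
Context {R : realType} {m : nat}.
Implicit Types (u v w : 'rV[R]_m) (D : set 'rV[R]_m).

(* An arbitrary norm on R^m, kept distinct from the canonical sup norm
   [`|u|] that MathComp-Analysis puts on ['rV[R]_m] (all of them induce the
   same topology). *)
Definition is_norm (nrm : 'rV[R]_m -> R) : Prop :=
  [/\ forall u v, nrm (u + v) <= nrm u + nrm v,
      forall (a : R) u, nrm (a *: u) = `|a| * nrm u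
    & forall u, nrm u = 0 -> u = 0].

Definition dotp u v : R := \sum_(j < m) u 0 j * v 0 j.

Definition l2norm u : R := Num.sqrt (dotp u u).

(* The condition [forall w, nrm (pos_part w) <= nrm w] holds for every l_q norm.
   When the domain is not the whole space, the bound of [gbarK] by [gbarNstar]
   fails for norms violating it: take p = 2, eps = 1, L = 0, one cluster
   d_1 = (0, -1), d_2 = (0, 1), ||w|| = |w_2| + 10 |w_1 + w_2|, and
   g(u) = u_1 on D = S = {u | u_2 >= -1}.  Then [gbarK] = 1 (at u = (1, -1)),
   but w_2 >= 0 forces w_1 <= ||w|| / 10, so [gbarNstar] < 0.72. *)
Definition pos_part u : 'rV[R]_m := \row_(j < m) Num.max (u 0 j) 0.

Definition proper_fun (f : 'rV[R]_m -> \bar R) : Prop :=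
  (forall u, (-oo < f u)%E) /\ (exists u, (f u < +oo)%E).

(* Only meaningful for f never equal to -oo (e.g. proper), so that the
   right-hand side has no [+oo - oo]; recall [0 * +oo = 0] in [\bar R]. *)
Definition convex_efun (f : 'rV[R]_m -> \bar R) : Prop :=
  forall u v (t : R), 0 <= t <= 1 ->
    (f (t *: u + (1 - t) *: v)%R
       <= t%:E * f u + (1 - t)%R%:E * f v)%E.

Definition le_vec u v : Prop := forall j, u 0 j <= v 0 j.

(* A product of intervals, the j-th one being bounded on the left by [b j]
   (closed, open, or -oo, i.e. no bound) and unbounded on the right. *)
Definition only_lower_bounded D : Prop :=
  exists b : 'I_m -> itv_bound R,
    D = [set u | forall j, u 0 j \in Interval (b j) +oo%O].

Definition only_upper_bounded D : Prop :=
  exists b : 'I_m -> itv_bound R,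
    D = [set u | forall j, u 0 j \in Interval -oo%O (b j)].

Definition increasing_on D (f : 'rV[R]_m -> \bar R) : Prop :=
  forall u v, D u -> D v -> le_vec u v -> (f u <= f v)%E.

Definition decreasing_on D (f : 'rV[R]_m -> \bar R) : Prop :=
  forall u v, D u -> D v -> le_vec u v -> (f v <= f u)%E.

(* [a] is the gradient of [f] at [u], with increments [v - u] restricted to
   [v] in D: the usual gradient at interior points of D, one-sided at the
   points of D on its boundary. *)
Definition is_gradient D (f : 'rV[R]_m -> R) u (a : 'rV[R]_m) : Prop :=
  forall e : R, 0 < e ->
    \forall v \near within D (nbhs u),
      `|f v - f u - dotp a (v - u)| <= e * l2norm (v - u).

(* [fine] is harmless here: [h] is finite on D in all uses. *)
Definition L_smooth_on D (h : 'rV[R]_m -> \bar R) (L : R) : Prop :=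
  exists grad : 'rV[R]_m -> 'rV[R]_m,
    (forall u, D u -> is_gradient D (fun v => fine (h v)) u (grad u)) /\
    (forall u v, D u -> D v ->
       l2norm (grad v - grad u) <= L * l2norm (u - v)).

End ConvexAnalysis.

Definition domain_assumption {R : realType} {m n : nat}
    (X : set 'rV[R]_n) (g : 'rV[R]_m -> 'rV[R]_n -> \bar R)
    (D : set 'rV[R]_m) : Prop :=
  [\/ D = setT,
      (forall x, X x -> increasing_on D (g ^~ x)) /\ only_lower_bounded D
    | (forall x, X x -> decreasing_on D (g ^~ x)) /\ only_upper_bounded D].

Section Clusters.
Context {R : realType} {m N K : nat}.
Implicit Types (C : 'I_K -> {set 'I_N}) (d : 'I_N -> 'rV[R]_m).

Definition is_clustering C : Prop :=
  [/\ forall k, (0 < #|C k|)%N,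
      forall k l i, i \in C k -> i \in C l -> k = l
    & forall i, exists k, i \in C k].

Definition cluster_mean C d (k : 'I_K) : 'rV[R]_m :=
  #|C k|%:R^-1 *: \sum_(i in C k) d i.

Definition cluster_dispersion C d : R :=
  N%:R^-1 * \sum_(k < K) \sum_(i in C k) l2norm (d i - cluster_mean C d k) ^+ 2.

End Clusters.

(* Worst-case values for a fixed decision: [h] stands for [g(., x)] and the
   maxima are taken as suprema in [\bar R]. *)
Section WorstCase.
Context {R : realType} {m : nat}.
Variables (nrm : 'rV[R]_m -> R) (p : nat) (eps : R).
Implicit Types (S : set 'rV[R]_m) (h : 'rV[R]_m -> \bar R).

Definition gbarN S h (N : nat) (d : 'I_N -> 'rV[R]_m) : \bar R :=
  ereal_sup [set ((N%:R^-1)%:E * \sum_(i < N) h (v i))%E | v in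
    [set v : 'I_N -> 'rV[R]_m |
      N%:R^-1 * \sum_(i < N) nrm (v i - d i) ^+ p <= eps ^+ p /\
      forall i, S (v i)]].

Definition gbarNstar h (N : nat) (d : 'I_N -> 'rV[R]_m) : \bar R :=
  ereal_sup [set ((N%:R^-1)%:E * \sum_(i < N) h (v i))%E | v in
    [set v : 'I_N -> 'rV[R]_m |
      N%:R^-1 * \sum_(i < N) nrm (v i - d i) ^+ p <= eps ^+ p]].

Definition gbarK S h (N K : nat) (C : 'I_K -> {set 'I_N})
    (d : 'I_N -> 'rV[R]_m) : \bar R :=
  ereal_sup [set (\sum_(k < K) (#|C k|%:R / N%:R)%R%:E * h (u k))%E | u in
    [set u : 'I_K -> 'rV[R]_m |
      \sum_(k < K) #|C k|%:R / N%:R * nrm (u k - cluster_mean C d k) ^+ p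
        <= eps ^+ p /\
      forall k, S (u k)]].

End WorstCase.

(* Main.v *)
Require Import Defs.
From HB Require Import structures.
From mathcomp Require Import all_boot all_order all_algebra.
From mathcomp Require Import all_classical all_reals all_analysis.
From mathcomp Require Import ring lra.

Import Order.TTheory GRing.Theory Num.Theory.
Import numFieldNormedType.Exports.

Local Open Scope classical_set_scope.
Local Open Scope ring_scope.

(** Both inequalities transport a feasible point of one maximization problem
    to the other and compare objective values cluster by cluster.

    For the first one, replace the points [v_i] of each cluster by their mean.
    The mean stays in the convex set [S]; Jensen's inequality for the concave
    [g] shows that the objective does not decrease, and Jensen's inequality for
    the convex function [nrm _ ^+ p] shows that the transport budget is not
    exceeded ([gbarN_le_gbarK]).

    For the second one, let [w_k = u_k - dbar_k] be the displacement of the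
    mean of cluster [k], and move every data point of that cluster by one
    common vector [s_k].  If [D] is the whole space, [s_k = w_k].  If [D] is
    bounded only from below and [g] is increasing, moving a data point by
    [w_k] may leave [D]; moving it by the positive part of [w_k] does not.  By
    the hypothesis on [nrm] the positive part costs no more than [w_k], and by
    monotonicity [g] is at least as large at [dbar_k + s_k] as at [u_k]
    ([dominating_shift]; the decreasing case is symmetric).  It remains to compare [g] at [z_k = dbar_k + s_k] with its
    average over the points [d_i + s_k], whose mean is [z_k].  Smoothness
    bounds [g] from below by its linearization at [z_k] minus [L / 2] times
    the squared distance ([descent_lemma]); averaging over the cluster cancels
    the linear terms, and the quadratic terms are those of the dispersion
    ([mean_descent]). *)

(** * Jensen's inequality for finite means *)

(** Convexity of the set [A] is part of the definition, so that one induction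
    gives both membership of a mean in [A] and Jensen's inequality there. *)
Definition convex_on {R : realType} {V : lmodType R} (A : set V) (F : V -> R) :=
  forall a b t, A a -> A b -> 0 <= t <= 1 ->
    A (t *: a + (1 - t) *: b) /\
    F (t *: a + (1 - t) *: b) <= t * F a + (1 - t) * F b.

(** Induction on the size of [B]: the mean of [n + 2] points is the convex
    combination, with weight [1 / (n + 2)], of one of them and the mean of the
    others. *)
Lemma convex_on_mean (R : realType) (V : lmodType R) (A : set V) (F : V -> R)
    (I : finType) (B : {set I}) (v : I -> V) :
  convex_on A F -> (0 < #|B|)%N -> (forall i, i \in B -> A (v i)) ->
  A (#|B|%:R^-1 *: \sum_(i in B) v i) /\
  F (#|B|%:R^-1 *: \sum_(i in B) v i) <= #|B|%:R^-1 * \sum_(i in B) F (v i).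
Proof.
move=> cvxF; move Bn : #|B| => [//|n] _.
elim: n B Bn => [|n IHn] B Bn Av /=.
  move/eqP/cards1P: Bn Av => [i ->] Av.
  by rewrite !big_set1 invr1 scale1r mul1r; split=> //; apply: Av; rewrite inE.
have /card_gt0P [i iB] : (0 < #|B|)%N by rewrite Bn.
have Bi : #|B :\ i| = n.+1 by move: Bn; rewrite (cardsD1 i) iB => -[].
have [j /setD1P [_ /Av] //|AM FM] := IHn _ Bi.
rewrite !(big_setD1 i iB) /=.
set M := \sum_(j in B :\ i) v j in AM FM *.
set G := \sum_(j in B :\ i) F (v j) in FM *.
have n1 : n.+1%:R != 0 :> R by rewrite pnatr_eq0.
have n2 : n.+2%:R != 0 :> R by rewrite pnatr_eq0.
have n2E : n.+2%:R = n.+1%:R + 1 :> R by rewrite -addn1 natrD.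
pose t : R := n.+2%:R^-1.
have tE : 1 - t = n.+2%:R^-1 * n.+1%:R.
  rewrite /t [X in _ * X](_ : _ = n.+2%:R - 1) ?mulrBr ?mulVf ?mulr1 //.
  by rewrite n2E addrK.
have t01 : 0 <= t <= 1.
  by rewrite /t invr_ge0 ler0n invf_le1 ?ltr0n // ler1n.
have -> : n.+2%:R^-1 *: (v i + M) = t *: v i + (1 - t) *: (n.+1%:R^-1 *: M).
  by rewrite scalerDr scalerA tE mulfK.
have [? le1] := cvxF _ _ _ (Av i iB) AM t01.
split=> //; apply: (le_trans le1).
have -> : n.+2%:R^-1 * (F (v i) + G) = t * F (v i) + (1 - t) * (n.+1%:R^-1 * G).
  by rewrite mulrDr mulrA tE mulfK.
rewrite lerD2l ler_wpM2l //; by case/andP: t01 => _; rewrite subr_ge0.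
Qed.

(** By induction on [p]: multiply the inequality for [p] by
    [t * a + (1 - t) * b].  The result falls short of the right-hand side for
    [p.+1] by [t * (1 - t) * ((a - b) * (a ^+ p - b ^+ p))], where [a - b] and
    [a ^+ p - b ^+ p] have the same sign. *)
Lemma exprn_convex (R : realDomainType) (a b t : R) (p : nat) :
  0 <= a -> 0 <= b -> 0 <= t <= 1 ->
  (t * a + (1 - t) * b) ^+ p <= t * a ^+ p + (1 - t) * b ^+ p.
Proof.
move=> a0 b0 /andP[t0 t1]; elim: p => [|p IHp].
  by rewrite !expr0 !mulr1 addrC subrK.
have ab0 : 0 <= t * a + (1 - t) * b by rewrite addr_ge0 // mulr_ge0 // subr_ge0.
rewrite exprS; apply: (le_trans (ler_wpM2l ab0 IHp)).
have cross : 0 <= (a - b) * (a ^+ p - b ^+ p).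
  have [leab|/ltW leba] := leP a b.
    by rewrite mulr_le0 ?subr_le0 ?lerXn2r.
  by rewrite mulr_ge0 ?subr_ge0 ?lerXn2r.
rewrite -subr_ge0 !exprS.
have -> : t * (a * a ^+ p) + (1 - t) * (b * b ^+ p) -
    (t * a + (1 - t) * b) * (t * a ^+ p + (1 - t) * b ^+ p) =
  t * (1 - t) * ((a - b) * (a ^+ p - b ^+ p)) by ring.
by apply: mulr_ge0 => //; rewrite mulr_ge0 ?subr_ge0.
Qed.

Section Norm.
Context {R : realType} {m : nat} (nrm : 'rV[R]_m -> R).
Hypothesis nrm_norm : is_norm nrm.

Lemma is_norm0 : nrm 0 = 0.
Proof.
by case: nrm_norm => _ nZ _; rewrite -(scale0r 0) nZ normr0 mul0r.
Qed.

Lemma is_normN u : nrm (- u) = nrm u.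
Proof. by case: nrm_norm => _ nZ _; rewrite -scaleN1r nZ normrN1 mul1r. Qed.

Lemma is_norm_ge0 u : 0 <= nrm u.
Proof.
case: (nrm_norm) => nD _ _; have := nD u (- u).
by rewrite subrr is_norm0 is_normN; lra.
Qed.

Lemma is_norm_pow_convex (p : nat) : convex_on setT (fun u => nrm u ^+ p).
Proof.
move=> a b t _ _ t01; split=> //.
apply: le_trans (exprn_convex _ _ _ _ _ (is_norm_ge0 a) (is_norm_ge0 b) t01).
case: (nrm_norm) => nD nZ _; case/andP: t01 => t0 t1.
rewrite lerXn2r ?nnegrE ?is_norm_ge0 ?addr_ge0 ?mulr_ge0 ?is_norm_ge0
  ?subr_ge0 //.
apply: (le_trans (nD _ _)); rewrite !nZ !ger0_norm ?subr_ge0 //.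
Qed.

End Norm.

(** * The Euclidean inner product *)

Section DotProduct.
Context {R : realType} {m : nat}.
Implicit Types u v w : 'rV[R]_m.

Lemma dotpDr u v w : dotp u (v + w) = dotp u v + dotp u w.
Proof. by rewrite -big_split; apply: eq_bigr => j _; rewrite mxE mulrDr. Qed.

Lemma dotpBl u v w : dotp (u - v) w = dotp u w - dotp v w.
Proof.
by rewrite -sumrB; apply: eq_bigr => j _; rewrite !mxE mulrDl mulNr.
Qed.

Lemma dotpC u v : dotp u v = dotp v u.
Proof. by apply: eq_bigr => j _; rewrite mulrC. Qed.

Lemma dotpBr u v w : dotp u (v - w) = dotp u v - dotp u w.
Proof. by rewrite !(dotpC u) dotpBl. Qed.

Lemma dotpZr a u v : dotp u (a *: v) = a * dotp u v.
Proof.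
by rewrite mulr_sumr; apply: eq_bigr => j _; rewrite !mxE mulrCA.
Qed.

Lemma dotp0r u : dotp u 0 = 0.
Proof. by rewrite -(scale0r 0) dotpZr mul0r. Qed.

Lemma dotp_sumr u (I : finType) (P : pred I) (F : I -> 'rV[R]_m) :
  dotp u (\sum_(i | P i) F i) = \sum_(i | P i) dotp u (F i).
Proof. exact: (big_morph _ (dotpDr u) (dotp0r u)). Qed.

Lemma dotpvv_ge0 u : 0 <= dotp u u.
Proof. by apply: sumr_ge0 => j _; rewrite -expr2 sqr_ge0. Qed.

Lemma l2norm_ge0 u : 0 <= l2norm u.
Proof. exact: sqrtr_ge0. Qed.

Lemma l2norm_sqr u : l2norm u ^+ 2 = dotp u u.
Proof. by rewrite sqr_sqrtr // dotpvv_ge0. Qed.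

Lemma l2normZ a u : l2norm (a *: u) = `|a| * l2norm u.
Proof.
rewrite /l2norm -sqrtr_sqr -sqrtrM ?sqr_ge0 //; congr Num.sqrt.
by rewrite mulr_sumr; apply: eq_bigr => j _; rewrite !mxE; ring.
Qed.

Lemma l2norm_eq0 u : l2norm u = 0 -> u = 0.
Proof.
move=> u0; have /eqP : dotp u u = 0 by rewrite -l2norm_sqr u0 expr0n.
rewrite psumr_eq0 => [/allP uu0|j _]; last by rewrite -expr2 sqr_ge0.
apply/rowP => j; rewrite mxE; apply/eqP.
by have := uu0 j; rewrite mem_index_enum mulf_eq0 orbb; apply.
Qed.

(** Expand the squared length of [l2norm v *: u - l2norm u *: v]. *)
Lemma cauchy_schwarz u v : dotp u v <= l2norm u * l2norm v.
Proof.
have [/l2norm_eq0 ->|u0] := eqVneq (l2norm u) 0.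
  by rewrite dotpC dotp0r mulr_ge0 ?l2norm_ge0.
have [/l2norm_eq0 ->|v0] := eqVneq (l2norm v) 0.
  by rewrite dotp0r mulr_ge0 ?l2norm_ge0.
have uv_gt0 : 0 < l2norm u * l2norm v.
  by rewrite mulr_gt0 // lt_neqAle eq_sym ?u0 ?v0 l2norm_ge0.
have := dotpvv_ge0 (l2norm v *: u - l2norm u *: v).
rewrite dotpBl !dotpBr !dotpZr.
rewrite !(dotpC (_ *: _)) !dotpZr -!l2norm_sqr (dotpC v u).
move: uv_gt0; set a := l2norm u; set b := l2norm v => ab_gt0 sq_ge0.
have : 0 <= (2 * (a * b)) * (a * b - dotp u v).
  by move: sq_ge0; congr (_ <= _); ring.
by rewrite pmulr_rge0 ?subr_ge0 //; lra.
Qed.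

End DotProduct.

(** * The quadratic lower bound for smooth functions *)

(** The first-order expansion of [f] restricted to a line.  The factor
    [1 + l2norm w] used in the proof absorbs the length of [w], which may be
    [0]. *)
Lemma gradient_along_line (R : realType) (m : nat) (D : set 'rV[R]_m)
    (f : 'rV[R]_m -> R) (z w a : 'rV[R]_m) (t e : R) :
  is_gradient D f (z + t *: w) a -> 0 < e ->
  \forall s \near nbhs t, D (z + s *: w) ->
    `|f (z + s *: w) - f (z + t *: w) - (s - t) * dotp a w| <= e * `|s - t|.
Proof.
move=> grada e0.
have w1 : 0 < 1 + l2norm w by rewrite ltr_wpDr ?l2norm_ge0.
have near_a := grada _ (divr_gt0 e0 w1).
have line_cont : (fun s : R => z + s *: w) @ t --> z + t *: w.
  by apply: cvgD; [exact: cvg_cst|apply: cvgZr_tmp; exact: cvg_id].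
have near_line : \forall s \near nbhs t, D (z + s *: w) ->
    `|f (z + s *: w) - f (z + t *: w) - dotp a (z + s *: w - (z + t *: w))|
      <= e / (1 + l2norm w) * l2norm (z + s *: w - (z + t *: w)).
  exact: line_cont _ near_a.
apply: filterS near_line => s le_s Ds.
have dE : z + s *: w - (z + t *: w) = (s - t) *: w.
  by rewrite scalerBl opprD addrACA subrr add0r.
have := le_s Ds; rewrite dE dotpZr l2normZ => /le_trans; apply.
set x := `|s - t|; set b := l2norm w in w1 *.
have -> : e / (1 + b) * (x * b) = e * x * (b / (1 + b)) by ring.
apply: ler_piMr; first exact: mulr_ge0 (ltW e0) (normr_ge0 _).
by rewrite ler_pdivrMr // mul1r lerDr ler01.
Qed.

Lemma is_derive_of_expansion (R : realType) (phi : R -> R) (t c : R) :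
  (forall e, 0 < e ->
     \forall s \near nbhs t, `|phi s - phi t - (s - t) * c| <= e * `|s - t|) ->
  is_derive t 1 phi c.
Proof.
move=> expand.
have quot :
    (fun h : R => h^-1 *: ((phi \o shift t) (h *: 1) - phi t)) @ 0^' --> c.
  apply/cvgrPdist_le => e e0.
  have shift_cvg : (fun h : R => h + t) @ (0 : R) --> t.
    by rewrite -[X in _ --> X]add0r; apply: cvgD; [exact: cvg_id|exact: cvg_cst].
  have expand0 : \forall h \near (0 : R),
      `|phi (h + t) - phi t - (h + t - t) * c| <= e * `|h + t - t|.
    exact: shift_cvg _ (expand e e0).
  near=> h.
  have h0 : h != 0 by near: h; exact: nbhs_dnbhs_neq.
  have : `|phi (h + t) - phi t - h * c| <= e * `|h|.
    near: h; apply: cvg_within; apply: filterS expand0 => h /=.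
    by rewrite addrK.
  rewrite /= distrC => le_h.
  rewrite [X in `|X|](_ : _ = h^-1 * (h * c - (phi (h + t) - phi t))); last first.
    by rewrite [h%:A]mulr1 [RHS]mulrBr mulKf.
  by rewrite normrM normfV ler_pdivrMl ?normr_gt0 // [leRHS]mulrC.
apply: DeriveDef.
  by apply/cvg_ex; exists c.
exact: cvg_lim quot.
Unshelve. all: by end_near.
Qed.

(** Along the segment from [z] to [z + w], the derivative of [f] at time [t]
    falls below its initial value [dotp (grad z) w] by at most
    [t * L * l2norm w ^+ 2], so adding [t ^+ 2 * (L / 2 * l2norm w ^+ 2)]
    to the deviation of [f] from its linearization makes it nondecreasing; the
    mean value theorem concludes.  The gradient being one-sided on the boundary
    of [D], differentiability holds inside the segment and only continuity at
    its ends. *)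
Lemma descent_lemma (R : realType) (m : nat) (D : set 'rV[R]_m)
    (f : 'rV[R]_m -> R) (grad : 'rV[R]_m -> 'rV[R]_m) (L : R)
    (z w : 'rV[R]_m) :
  (forall t, 0 <= t <= 1 -> D (z + t *: w)) ->
  (forall u, D u -> is_gradient D f u (grad u)) ->
  (forall u v, D u -> D v -> l2norm (grad v - grad u) <= L * l2norm (u - v)) ->
  f z + dotp (grad z) w - L / 2 * l2norm w ^+ 2 <= f (z + w).
Proof.
move=> segD gradf lip.
pose phi (t : R) := f (z + t *: w).
pose psi : R -> R :=
  phi - dotp (grad z) w *: id + (L / 2 * l2norm w ^+ 2) *: (id ^+ 2).
pose dphi (t : R) := dotp (grad (z + t *: w)) w.
have phi_der (t : R) : t \in `]0, 1[%R -> is_derive t 1 phi (dphi t).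
  move=> t01; apply: is_derive_of_expansion => e e0.
  have t01' : 0 <= t <= 1 by rewrite !ltW ?(itvP t01).
  have := gradient_along_line _ _ _ _ _ _ _ _ _ (gradf _ (segD t t01')) e0.
  have : \forall s \near nbhs t, s \in `]0, 1[%R.
    exact: near_in_itvoo.
  apply: filterS2 => s s01; apply; apply: segD.
  by rewrite !ltW ?(itvP s01).
have phi_cont : {within `[0, 1], continuous phi}.
  apply/subspace_continuousP => t /= t01.
  have t01' : 0 <= t <= 1 by rewrite !(itvP t01).
  have expand e : 0 < e -> \forall s \near within `[0, 1] (nbhs t),
      `|phi s - phi t - (s - t) * dphi t| <= e * `|s - t|.
    move=> e0.
    have := gradient_along_line _ _ _ _ _ _ _ _ _ (gradf _ (segD t t01')) e0.
    rewrite near_withinE; apply: filterS => s le_s /= s01.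
    apply: le_s; apply: segD.
    by rewrite !(itvP s01).
  have lin : \forall s \near within `[0, 1] (nbhs t),
      `|phi s - phi t| <= (1 + `|dphi t|) * `|s - t|.
    apply: filterS (expand 1 ltr01) => s le_s.
    rewrite -[phi s - phi t](subrK ((s - t) * dphi t)).
    rewrite (le_trans (ler_normD _ _)) //.
    by rewrite [leRHS]mulrDl lerD // normrM [leLHS]mulrC.
  apply/cvgrPdist_le => e e0.
  have near_t : \forall s \near nbhs t, `|t - s| <= e / (1 + `|dphi t|).
    by apply: cvgr_dist_le; [exact: cvg_id|rewrite divr_gt0 // ltr_wpDr].
  have near_t01 : \forall s \near within `[0, 1] (nbhs t),
      `|t - s| <= e / (1 + `|dphi t|).
    exact: cvg_within near_t.
  apply: filterS2 lin near_t01 => s le_s; rewrite (distrC t) => le_t.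
  rewrite (distrC (phi t)) (le_trans le_s) // mulrC -ler_pdivlMr //.
have psi_der (t : R) : t \in `]0, 1[%R ->
    is_derive t 1 psi (dphi t - dotp (grad z) w + t * (L * l2norm w ^+ 2)).
  move=> t01; have ? := phi_der t t01; apply: is_derive_eq.
  rewrite /= expr1 /GRing.scale /=; lra.
have psi_cont : {within `[0, 1], continuous psi}.
  move=> t; apply: cvgD; first apply: cvgB; first exact: phi_cont.
    exact/continuous_subspaceT/scaler_continuous.
  apply: continuous_subspaceT => s; apply: cvgZl_tmp.
  by rewrite exprfctE; exact: exprn_continuous.
have [c c01 incr] := MVT ltr01 psi_der psi_cont.
have c01' : 0 <= c <= 1 by rewrite !ltW ?(itvP c01).
have z0 : z + 0 *: w = z by rewrite scale0r addr0.
have Dz : D z by rewrite -z0; apply: segD; rewrite lexx ler01.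
have dphi_ge : dotp (grad z) w - dphi c <= c * (L * l2norm w ^+ 2).
  rewrite -dotpBl (le_trans (cauchy_schwarz _ _)) //.
  have := lip _ _ (segD c c01') Dz.
  rewrite (addrC z) addrK l2normZ ger0_norm; last by case/andP: c01'.
  move=> /(ler_wpM2r (l2norm_ge0 w)) /le_trans; apply.
  by rewrite le_eqVlt; apply/orP; left; apply/eqP; ring.
have psiE (t : R) : psi t =
    phi t - dotp (grad z) w * t + L / 2 * l2norm w ^+ 2 * t ^+ 2.
  by rewrite /psi exprfctE.
move: incr; rewrite !psiE /phi z0 scale1r; lra.
Qed.

(** * Concave objectives on their domain *)

Section ConcaveObjective.
Context {R : realType} {m : nat} {h : 'rV[R]_m -> \bar R} {D : set 'rV[R]_m}.
Hypothesis h_domain : [set u | h u \is a fin_num] = D.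

Lemma domain_fin_num u : D u -> h u = (fine (h u))%:E.
Proof. by rewrite -h_domain => hu; rewrite fineK. Qed.

(** A convex combination of points of [D] is again in [D]: there [- h] is
    bounded above by a real number, and properness excludes [-oo]. *)
Lemma convex_on_domain :
  proper_fun (fun u => - h u)%E -> convex_efun (fun u => - h u)%E ->
  convex_on D (fun u => - fine (h u)).
Proof.
move=> [h_ltoo _] h_cvx a b t Da Db t01.
have := h_cvx a b t t01; have := h_ltoo (t *: a + (1 - t) *: b).
rewrite (domain_fin_num a Da) (domain_fin_num b Db) -!EFinN -!EFinM -EFinD /=.
rewrite -h_domain /=; case: (h _) => [r| |] //=.
Qed.

Lemma mean_of_domain_values (N : nat) (v : 'I_N -> 'rV[R]_m) :
  (forall i, D (v i)) ->
  ((N%:R^-1)%:E * \sum_(i < N) h (v i))%E =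
  (N%:R^-1 * \sum_(i < N) fine (h (v i)))%:E.
Proof.
move=> Dv; rewrite (eq_bigr (fun i => (fine (h (v i)))%:E)) => [|i _].
  by rewrite sumEFin.
exact: domain_fin_num.
Qed.

Lemma weighted_domain_values (K : nat) (c : 'I_K -> R) (u : 'I_K -> 'rV[R]_m) :
  (forall k, D (u k)) ->
  (\sum_(k < K) (c k)%:E * h (u k))%E = (\sum_(k < K) c k * fine (h (u k)))%:E.
Proof.
move=> Du; rewrite -sumEFin; apply: eq_bigr => k _.
by rewrite (domain_fin_num _ (Du k)).
Qed.

End ConcaveObjective.

Lemma sub_convex_on (R : realType) (m : nat) (S D : set 'rV[R]_m)
    (F : 'rV[R]_m -> R) :
  convex_set S -> S `<=` D -> convex_on D F -> convex_on S F.
Proof.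
move=> cvxS SD cvxF a b t Sa Sb t01; split; last first.
  by have [] := cvxF a b t (SD _ Sa) (SD _ Sb) t01.
case/andP: (t01) => t0 t1.
have := cvxS a b (Itv01 t0 t1); rewrite !inE; exact.
Qed.

(** * Averages over clusters *)

Section Clustering.
Context {R : realType} {N K : nat} {C : 'I_K -> {set 'I_N}}.
Hypothesis C_clustering : is_clustering C.

Lemma sum_over_clusters (V : nmodType) (F : 'I_N -> V) :
  \sum_(i < N) F i = \sum_(k < K) \sum_(i in C k) F i.
Proof.
case: C_clustering => _ disjC coverC.
rewrite (exchange_big_dep xpredT) //=; apply: eq_bigr => i _.
have [k ik] := coverC i.
rewrite (big_pred1 k) // => l; apply/idP/eqP => [il|-> //].
exact: disjC il ik.
Qed.

Lemma mean_over_clusters (F : 'I_N -> R) :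
  N%:R^-1 * \sum_(i < N) F i =
  \sum_(k < K) #|C k|%:R / N%:R * (#|C k|%:R^-1 * \sum_(i in C k) F i).
Proof.
case: (C_clustering) => C_gt0 _ _.
rewrite sum_over_clusters mulr_sumr; apply: eq_bigr => k _.
rewrite mulrA; congr (_ * _).
by rewrite mulrAC divff ?mul1r // pnatr_eq0 -lt0n.
Qed.

End Clustering.

(** * Comparison of the worst-case values *)

Section Comparison.
Context {R : realType} {m N K : nat}.
Context {S D : set 'rV[R]_m} {h : 'rV[R]_m -> \bar R}.
Context {nrm : 'rV[R]_m -> R} {p : nat} {eps : R}.
Context {d : 'I_N -> 'rV[R]_m} {C : 'I_K -> {set 'I_N}}.
Hypotheses (S_convex : convex_set S) (S_sub_D : S `<=` D).
Hypotheses (h_proper : proper_fun (fun u => - h u)%E)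
  (h_convex : convex_efun (fun u => - h u)%E)
  (h_domain : [set u | h u \is a fin_num] = D).
Hypotheses (C_clustering : is_clustering C) (nrm_norm : is_norm nrm).

Let f u := fine (h u).

Let f_cvx : convex_on D (fun u => - f u).
Proof. exact: convex_on_domain. Qed.

Let f_cvx_S : convex_on S (fun u => - f u).
Proof. exact: sub_convex_on f_cvx. Qed.

(** Merging the points of each cluster into their mean keeps feasibility and
    does not decrease the concave objective. *)
Lemma gbarN_le_gbarK : (gbarN nrm p eps S h d <= gbarK nrm p eps S h C d)%E.
Proof.
case: (C_clustering) => C_gt0 _ _.
apply: ge_ereal_sup => _ [v [v_eps Sv] <-].
pose u k := cluster_mean C v k.
have Su_fu k : S (u k) /\
    - f (u k) <= #|C k|%:R^-1 * \sum_(i in C k) - f (v i).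
  exact: convex_on_mean f_cvx_S (C_gt0 k) (fun i _ => Sv i).
apply: (le_trans (y := (\sum_(k < K) (#|C k|%:R / N%:R)%R%:E * h (u k))%E)).
  rewrite (mean_of_domain_values h_domain) => [|i]; last exact: S_sub_D.
  rewrite (weighted_domain_values h_domain) => [|k]; last first.
    exact/S_sub_D/(Su_fu k).1.
  rewrite lee_fin (mean_over_clusters C_clustering); apply: ler_sum => k _.
  rewrite ler_wpM2l ?divr_ge0 //.
  by have [_] := Su_fu k; rewrite sumrN mulrN lerN2.
apply: ereal_sup_ubound; exists u => //; split=> [|k]; last exact: (Su_fu k).1.
apply: le_trans v_eps; rewrite (mean_over_clusters C_clustering).
apply: ler_sum => k _; rewrite ler_wpM2l ?divr_ge0 //.
rewrite /u /cluster_mean -scalerBr -sumrB.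
by have [] := convex_on_mean _ _ _ _ _ (C k) (fun i => v i - d i)
  (is_norm_pow_convex nrm nrm_norm p) (C_gt0 k).
Qed.

Section Smooth.
Context {L : R}.
Hypothesis h_smooth : L_smooth_on D h L.

(** Average the quadratic lower bounds based at the common point [ybar + s]:
    the deviations [y i - ybar] sum to [0], so the linear terms cancel. *)
Lemma mean_descent (I : finType) (B : {set I}) (y : I -> 'rV[R]_m)
    (s : 'rV[R]_m) (ybar := #|B|%:R^-1 *: \sum_(i in B) y i) :
  (0 < #|B|)%N -> (forall i, i \in B -> D (y i + s)) -> D (ybar + s) ->
  f (ybar + s) <=
    #|B|%:R^-1 * \sum_(i in B) (f (y i + s) + L / 2 * l2norm (y i - ybar) ^+ 2).
Proof.
move=> B_gt0 Dy Dybar; case: h_smooth => grad [gradP lip].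
have B0 : #|B|%:R != 0 :> R by rewrite pnatr_eq0 -lt0n.
have point i : i \in B -> f (ybar + s) + dotp (grad (ybar + s)) (y i - ybar) <=
    f (y i + s) + L / 2 * l2norm (y i - ybar) ^+ 2.
  move=> iB; rewrite -lerBlDr.
  have yE : y i + s = ybar + s + (y i - ybar) by rewrite [RHS]addrC addrA subrK.
  rewrite yE; apply: (descent_lemma _ _ _ _ _ _ _ _ _ gradP lip) => t t01.
  have [+ _] := f_cvx _ _ t (Dy i iB) Dybar t01.
  rewrite yE; set a := ybar + s; set b := y i - ybar.
  suff -> : t *: (a + b) + (1 - t) *: a = a + t *: b by [].
  by rewrite scalerDr scalerBl scale1r addrAC [t *: a + _]addrC subrK.
rewrite ler_pdivlMl ?lt_neqAle ?ler0n ?andbT 1?eq_sym //.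
apply: le_trans (ler_sum _ point).
rewrite big_split /= sumr_const -dotp_sumr sumrB sumr_const.
rewrite -[ybar *+ _]scaler_nat {2}/ybar scalerA divff //.
rewrite scale1r subrr dotp0r addr0.
by rewrite mulr_natl.
Qed.

(** The last hypothesis isolates all that is needed of the shape of [D]: a
    displacement [w] of a cluster mean can be traded for one [s] that costs no
    more, is at least as good for the objective, and can be applied to every
    data point of the cluster without leaving [D]. *)
Lemma gbarK_le_gbarNstar :
  (0 < N)%N -> (forall i, S (d i)) ->
  (forall w, exists s, nrm s <= nrm w /\
     forall y, D y -> D (y + s) /\
       (D (y + w) -> (h (y + w)%R <= h (y + s)%R)%E)) ->
  (gbarK nrm p eps S h C d <=
     gbarNstar nrm p eps h d + (L / 2 * cluster_dispersion C d)%:E)%E.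
Proof.
move=> N_gt0 Sd shiftP; case: (C_clustering) => C_gt0 disjC coverC.
apply: ge_ereal_sup => _ [u [u_eps Su] <-].
have Ddbar k : D (cluster_mean C d k).
  apply: S_sub_D.
  by have [] := convex_on_mean _ _ _ _ _ _ _ f_cvx_S (C_gt0 k) (fun i _ => Sd i).
have [s sP] := choice (fun k => shiftP (u k - cluster_mean C d k)).
have [cl clP] := choice coverC.
(* All points of a cluster receive the same displacement, that of their mean. *)
pose v i := d i + s (cl i).
have Dv i : D (v i) by have [_ /(_ (d i) (S_sub_D _ (Sd i))) []] := sP (cl i).
have vE k i : i \in C k -> v i = d i + s k.
  by move=> ik; rewrite /v (disjC _ _ _ (clP i) ik).
apply: (le_trans (y := ((N%:R^-1)%:E * \sum_(i < N) h (v i) +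
    (L / 2 * cluster_dispersion C d)%:E)%E)); last first.
  apply: leeD => //; apply: ereal_sup_ubound; exists v => //=.
  apply: le_trans u_eps; rewrite (mean_over_clusters C_clustering).
  apply: ler_sum => k _; rewrite ler_wpM2l ?divr_ge0 //.
  rewrite (eq_bigr (fun=> nrm (s k) ^+ p)) => [|i ik]; last first.
    by rewrite (vE k i ik) addrC addKr.
  rewrite sumr_const -[_ ^+ p *+ _]mulr_natl mulKf ?pnatr_eq0 -?lt0n //.
  by rewrite lerXn2r ?nnegrE ?is_norm_ge0 //; have [] := sP k.
rewrite (mean_of_domain_values h_domain) //.
rewrite (weighted_domain_values h_domain) => [|k]; last exact: S_sub_D.
rewrite -EFinD lee_fin.
have -> : N%:R^-1 * \sum_(i < N) f (v i) + L / 2 * cluster_dispersion C d =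
    \sum_(k < K) #|C k|%:R / N%:R * (#|C k|%:R^-1 * \sum_(i in C k)
      (f (d i + s k) + L / 2 * l2norm (d i - cluster_mean C d k) ^+ 2)).
  rewrite (mean_over_clusters C_clustering) /cluster_dispersion mulrCA.
  rewrite !mulr_sumr -big_split /=; apply: eq_bigr => k _.
  rewrite big_split /= !mulrDr; congr (_ + _).
    by congr (_ * (_ * _)); apply: eq_bigr => i ik; rewrite (vE k i ik).
  rewrite -mulr_sumr [RHS]mulrA; congr (_ * _).
  by rewrite mulrAC divff ?mul1r // pnatr_eq0 -lt0n.
apply: ler_sum => k _; rewrite ler_wpM2l ?divr_ge0 //.
have [_ /(_ _ (Ddbar k))] := sP k; rewrite subrKC => -[Dz uz].
apply: (le_trans (y := f (cluster_mean C d k + s k))).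
  by have := uz (S_sub_D _ (Su k)); rewrite (domain_fin_num h_domain _ Dz)
    (domain_fin_num h_domain _ (S_sub_D _ (Su k))) lee_fin.
apply: mean_descent => // i ik; rewrite -(vE k i ik); exact: Dv.
Qed.

End Smooth.
End Comparison.

(** * Displacements that stay in the domain *)

Lemma only_lower_bounded_up (R : realType) (m : nat) (D : set 'rV[R]_m) y z :
  only_lower_bounded D -> D y -> le_vec y z -> D z.
Proof.
move=> [b ->] /= Dy yz j; have := Dy j; rewrite !itv_boundlr !bnd_simp !andbT.
by move=> /le_trans; apply; rewrite bnd_simp.
Qed.

Lemma only_upper_bounded_down (R : realType) (m : nat) (D : set 'rV[R]_m) y z :
  only_upper_bounded D -> D y -> le_vec z y -> D z.
Proof.
move=> [b ->] /= Dy zy j; have := Dy j; rewrite !itv_boundlr !bnd_simp.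
by apply: le_trans; rewrite bnd_simp.
Qed.

(** Take [s = w] on the whole space; otherwise keep only the components of [w]
    that point away from the bound of [D], that is its positive part if the
    bound is a lower one and [- pos_part (- w)] if it is an upper one.
    Dropping the other components moves [y + w] in the direction in which [g]
    grows. *)
Lemma dominating_shift (R : realType) (m n : nat) (X : set 'rV[R]_n)
    (g : 'rV[R]_m -> 'rV[R]_n -> \bar R) (D : set 'rV[R]_m)
    (nrm : 'rV[R]_m -> R) (x : 'rV[R]_n) (w : 'rV[R]_m) :
  is_norm nrm -> X x -> domain_assumption X g D ->
  D = setT \/ (forall w, nrm (pos_part w) <= nrm w) ->
  exists s, nrm s <= nrm w /\
    forall y, D y -> D (y + s) /\
       (D (y + w) -> (g (y + w)%R x <= g (y + s)%R x)%E).
Proof.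
move=> nrm_norm Xx domA [->|nrm_pos]; first by exists w.
case: domA => [->|[g_incr lowD]|[g_decr uppD]]; first by exists w.
- exists (pos_part w); split=> // y Dy.
  have Dys : D (y + pos_part w).
    apply: (only_lower_bounded_up _ _ _ _ _ lowD Dy) => j.
    by rewrite !mxE lerDl le_max lexx orbT.
  split=> // Dyw; apply: g_incr => // j.
  by rewrite !mxE lerD2l le_max lexx.
- exists (- pos_part (- w)); split.
    by rewrite is_normN // -(is_normN _ nrm_norm w).
  move=> y Dy.
  have Dys : D (y - pos_part (- w)).
    apply: (only_upper_bounded_down _ _ _ _ _ uppD Dy) => j.
    by rewrite !mxE gerDl oppr_le0 le_max lexx orbT.
  split=> // Dyw; apply: g_decr => // j.
  by rewrite !mxE lerD2l lerNl le_max lexx.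
Qed.

(** * Clustering brackets the worst-case value *)

Theorem theorem4p1 (R : realType) (m n N K : nat)
    (S : set 'rV[R]_m) (X : set 'rV[R]_n) (D : set 'rV[R]_m)
    (g : 'rV[R]_m -> 'rV[R]_n -> \bar R)
    (nrm : 'rV[R]_m -> R) (d : 'I_N -> 'rV[R]_m) (C : 'I_K -> {set 'I_N})
    (eps : R) (x : 'rV[R]_n) (p : nat)
    (S_convex : convex_set S) (S_closed : closed S) (X_compact : compact X)
    (g_proper : forall y, X y -> proper_fun (fun u => - g u y)%E)
    (g_convex : forall y, X y -> convex_efun (fun u => - g u y)%E)
    (g_lsc : forall y, X y -> lower_semicontinuous (fun u => - g u y)%E)
    (g_domain : forall y, X y -> [set u | g u y \is a fin_num] = D)
    (S_sub_D : S `<=` D)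
    (N_gt0 : (0 < N)%N) (d_in_S : forall i, S (d i))
    (C_clustering : is_clustering C)
    (nrm_norm : is_norm nrm) (eps_gt0 : 0 < eps)
    (x_in_X : X x) (p_ge1 : (1 <= p)%N) :
  (gbarN nrm p eps S (g ^~ x) d <= gbarK nrm p eps S (g ^~ x) C d)%E /\
  (forall L : R,
     domain_assumption X g D ->
     L_smooth_on D (g ^~ x) L ->
     D = setT \/ (forall w, nrm (pos_part w) <= nrm w) ->
     (gbarK nrm p eps S (g ^~ x) C d
        <= gbarNstar nrm p eps (g ^~ x) d
           + (L / 2 * cluster_dispersion C d)%R%:E)%E).
Proof.
have h_proper := g_proper x x_in_X; have h_convex := g_convex x x_in_X.
have h_domain := g_domain x x_in_X.
split=> [|L domA h_smooth nrm_pos].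
  exact: (gbarN_le_gbarK S_convex S_sub_D h_proper h_convex h_domain).
apply: (gbarK_le_gbarNstar S_convex S_sub_D h_proper h_convex h_domain) => // w.
exact: dominating_shift domA nrm_pos.
Qed.
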